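(* Let $n$ be a positive integer and let $\mathcal{A}, \mathcal{B}$ be families of subsets of $[n]$. If $(\mathcal{A}, \mathcal{B})$ is a cancellative pair, then $$|\mathcal{A}|\,|\mathcal{B}| \le 2.25^n.$$
   Context: Here $[n]=\{1,\dots,n\}$. A pair $(\mathcal{A}, \mathcal{B})$ of families of subsets of $[n]$ is called cancellative if both of the following hold: (i) whenever $A, A' \in \mathcal{A}$ and $B \in \mathcal{B}$ satisfy $A \cup B=A' \cup B$, then $A=A'$; (ii) whenever $A \in \mathcal{A}$ and $B, B' \in \mathcal{B}$ satisfy $A \cup B=A \cup B'$, then $B=B'$. *)

(* Defs.v *)
From mathcomp Require Import all_boot.

Set Implicit Arguments.
Unset Strict Implicit.
Unset Printing Implicit Defensive.

Definition cancellative_pair (n : nat) (A B : {set {set 'I_n}}) : Prop :=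
  (forall X X' Y : {set 'I_n}, X \in A -> X' \in A -> Y \in B ->
     X :|: Y = X' :|: Y -> X = X') /\
  (forall X Y Y' : {set 'I_n}, X \in A -> Y \in B -> Y' \in B ->
     X :|: Y = X :|: Y' -> Y = Y').

(* Main.v *)
Require Import Defs.
From mathcomp Require Import all_boot all_order all_algebra.
From mathcomp Require Import ring lra.

Set Implicit Arguments.
Unset Strict Implicit.
Unset Printing Implicit Defensive.

Import Order.TTheory GRing.Theory Num.Theory.
Local Open Scope ring_scope.

(** The proof bounds weighted counts by induction on the number of coordinates
    that carry no weight.  Attach to each coordinate [i] of a set [D] a number
    [s i] in [[0, 1]]; let a member [X] of [A] pay a factor [1 - s i] for each
    [i] of [D] that it misses, and a member [Y] of [B] a factor [s i] for each
    [i] of [D] that it misses.  Let [E] contain [D].  The claim is that the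
    total weight of the members of [A] inside [E], times that of the members of
    [B] inside [E], is at most [(9/4) ^ #|E :\: D|].  With [D] empty and [E]
    full this is the theorem.

    When [D = E] the claim says that the product of the weights is at most [1]
    ([weighted_mass_le1]).  Fix [Y] in [B], and draw a random subset of
    [D :\: Y] that contains each [i] independently with probability [s i].
    Cancellation makes the traces [X :\: Y], for [X] in [A], pairwise distinct,
    so the probabilities [u X Y] of drawing them add up to at most [1].  Fixing
    [X] and exchanging [s] with [1 - s] gives a similar [v X Y].  Coordinate by
    coordinate, [u X Y * v X Y] is the product of the weights of [X] and [Y], so
    Cauchy-Schwarz turns the two bounds on sums into the bound on the product.

    In the induction step choose [i] in [E] outside [D].  Either drop [i] from
    [E], or add it to [D] with a weight [s i] that is still free.  If [f0], [f1]
    are the weights of the members of [A] without and with [i], and [g0], [g1]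
    those for [B], the induction hypothesis bounds [f0 * g0] as well as
    [((1 - s) * f0 + f1) * (s * g0 + g1)] for every [s] in [[0, 1]].  An
    inequality in four real numbers ([branching_bound]) then bounds
    [(f0 + f1) * (g0 + g1)] at the cost of a factor [9/4].  Being able to choose
    [s] away from [1/2] is what copes with families [A] and [B] of different
    densities. *)

(** Cauchy-Schwarz for termwise geometric means, in a form free of square roots
    so that it holds over any ordered field: expand both sides into double sums
    and apply the inequality of arithmetic and geometric means to each pair of
    indices. *)
Lemma sum_geometric_mean_sqr_le (R : realFieldType) (I : finType) (P : pred I)
    (a p q : I -> R) :
  (forall i, P i -> 0 <= p i) -> (forall i, P i -> 0 <= q i) ->
  (forall i, P i -> a i ^+ 2 = p i * q i) ->
  (\sum_(i | P i) a i) ^+ 2 <= (\sum_(i | P i) p i) * (\sum_(i | P i) q i).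
Proof.
move=> p_ge0 q_ge0 a2E.
have amgm i j : P i -> P j -> a i * a j *+ 2 <= p i * q j + p j * q i.
  move=> Pi Pj; have [pi qi] := (p_ge0 i Pi, q_ge0 i Pi).
  have [pj qj] := (p_ge0 j Pj, q_ge0 j Pj).
  have rhs_ge0 : 0 <= p i * q j + p j * q i by rewrite addr_ge0 ?mulr_ge0.
  apply: (le_trans (ler_norm _)).
  rewrite -(ler_pXn2r (ltn0Sn 1)) ?nnegrE ?normr_ge0 // real_normK ?num_real //.
  have -> : (a i * a j *+ 2) ^+ 2 = 4%:R * (a i ^+ 2) * (a j ^+ 2) by ring.
  rewrite !a2E // -subr_ge0.
  have -> : (p i * q j + p j * q i) ^+ 2 - 4%:R * (p i * q i) * (p j * q j)
    = (p i * q j - p j * q i) ^+ 2 by ring.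
  exact: sqr_ge0.
rewrite -(ler_pMn2r (ltn0Sn 1)) expr2 !big_distrlr /= [leRHS]mulr2n.
rewrite [X in _ <= _ + X]exchange_big /= -big_split -sumrMnl /=.
apply: ler_sum => i Pi; rewrite -big_split -sumrMnl /=.
by apply: ler_sum => j Pj; exact: amgm.
Qed.

(** If [f1 >= f0], then [f0 + f1 <= 2 * f1] and the value [s = 1] is enough;
    similarly [s = 0] if [g1 >= g0].  Otherwise put [a = f1 / f0], [b = g1 / g0]
    and [m = f0 * g0], so that the weighted hypothesis reads [(1 - s + a) * (s + b) * m <= r]; its two factors have a sum that does
    not depend on [s], so the best [s] makes them equal and yields
    [((1 + a + b) / 2) ^ 2 * m <= r].  If [(1 + a) * (1 + b) <= 9/4], the
    unweighted hypothesis suffices.  Otherwise [1 + a] and [1 + b] have sum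
    [S >= 3], and [(1 + a) * (1 + b) <= S ^ 2 / 4 <= 9/16 * (S - 1) ^ 2].
    Equality holds at [a = b = 1/2], [s = 1/2]. *)
Lemma branching_bound (R : realFieldType) (f0 f1 g0 g1 r : R) :
  0 <= f0 -> 0 <= f1 -> 0 <= g0 -> 0 <= g1 -> f0 * g0 <= r ->
  (forall s, 0 <= s <= 1 -> ((1 - s) * f0 + f1) * (s * g0 + g1) <= r) ->
  (f0 + f1) * (g0 + g1) <= 9%:R / 4%:R * r.
Proof.
move=> f0_ge0 f1_ge0 g0_ge0 g1_ge0 le_r weighted_le_r.
have r_ge0 : 0 <= r by apply: le_trans le_r; rewrite mulr_ge0.
have at1 : f1 * (g0 + g1) <= r.
  by have := weighted_le_r 1; rewrite subrr mul0r add0r mul1r; apply; lra.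
have at0 : (f0 + f1) * g1 <= r.
  by have := weighted_le_r 0; rewrite subr0 mul0r add0r mul1r; apply; lra.
(* Setting these two cases aside ensures that the balancing value of [s] below lies in
   [[0, 1]] and that [f0] and [g0] are invertible. *)
have [f1_large|f1_small] := leP f0 f1; first by nra.
have [g1_large|g1_small] := leP g0 g1; first by nra.
have f0_gt0 : 0 < f0 by lra.
have g0_gt0 : 0 < g0 by lra.
pose a := f1 / f0; pose b := g1 / g0.
have f1E : f1 = a * f0 by rewrite /a divfK ?gt_eqF.
have g1E : g1 = b * g0 by rewrite /b divfK ?gt_eqF.
have a01 : 0 <= a <= 1.
  by rewrite /a divr_ge0 //= ler_pdivrMr // mul1r ltW.
have b01 : 0 <= b <= 1.
  by rewrite /b divr_ge0 //= ler_pdivrMr // mul1r ltW.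
pose m := f0 * g0; have m_ge0 : 0 <= m by rewrite mulr_ge0.
have -> : (f0 + f1) * (g0 + g1) = (1 + a) * (1 + b) * m.
  by rewrite f1E g1E /m; ring.
have [small|large] := leP ((1 + a) * (1 + b)) (9%:R / 4%:R).
  by apply: le_trans (ler_wpM2l _ le_r); [exact: ler_wpM2r | lra].
(* [s = (1 + a - b) / 2] solves [1 - s + a = s + b]. *)
have balanced : ((1 + a + b) / 2%:R) ^+ 2 * m <= r.
  have := weighted_le_r ((1 + a - b) / 2%:R); rewrite f1E g1E.
  have -> : ((1 - (1 + a - b) / 2%:R) * f0 + a * f0) *
            ((1 + a - b) / 2%:R * g0 + b * g0) =
            ((1 + a + b) / 2%:R) ^+ 2 * m by rewrite /m; field.
  by apply; lra.
apply: (@le_trans _ _ (9%:R / 4%:R * (((1 + a + b) / 2%:R) ^+ 2 * m))); last first.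
  by rewrite ler_wpM2l //; lra.
rewrite [leRHS]mulrA ler_wpM2r //.
have sum_ge1 : 1 <= a + b by have := sqr_ge0 (a - b); nra.
by have := sqr_ge0 (a - b); nra.
Qed.

Section Mass.
Variables (R : realFieldType) (T : finType).
Implicit Types (t : T -> R) (D E : {set T}) (F : {set {set T}}).

(** The indices in [D] are those that carry a weight, paid by the sets that miss
    them; the indices in [E :\: D] are unconstrained, and those outside [E] are
    forbidden. *)
Definition mass t D E F : R :=
  \sum_(X in F | X \subset E) \prod_(i in D :\: X) t i.

Lemma mass_ge0 t D E F : (forall i, 0 <= t i) -> 0 <= mass t D E F.
Proof. by move=> t0; apply: sumr_ge0 => X _; apply: prodr_ge0. Qed.

Lemma mass_split t D E F i :
  mass t D E F = mass t D (E :\ i) F + mass t D E [set X in F | i \in X].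
Proof.
rewrite /mass (bigID (fun X : {set T} => i \in X)) /= addrC.
congr (_ + _); apply: eq_bigl => X.
  by rewrite subsetD1 andbA.
by rewrite inE andbAC.
Qed.

(** Giving a weight to a new index [i] multiplies the contribution of the sets
    that avoid [i] and leaves the other sets untouched: this is what makes the
    combination [s * g0 + g1] of [branching_bound] a weighted mass again. *)
Lemma mass_weight t t' D E F i :
  i \notin D -> {in D, t' =1 t} ->
  mass t' (i |: D) E F =
    t' i * mass t D (E :\ i) F + mass t D E [set X in F | i \in X].
Proof.
move=> iD tt'; rewrite (mass_split _ _ _ _ i); congr (_ + _).
  rewrite /mass big_distrr; apply: eq_bigr => X /andP[_].
  rewrite subsetD1 => /andP[_ iX] /=.
  rewrite setDUl (_ : [set i] :\: X = [set i]); last first.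
    by apply/setDidPl; rewrite disjoints1.
  rewrite big_setU1 ?inE ?negb_and ?iD ?orbT //=; congr (_ * _).
  by apply: eq_bigr => j; rewrite inE => /andP[_ /tt'].
apply: eq_bigr => X; rewrite inE => /andP[/andP[_ iX] _].
rewrite (_ : (i |: D) :\: X = D :\: X).
  by apply: eq_bigr => j; rewrite inE => /andP[_ /tt'].
by apply/setP=> j; rewrite !inE; case: eqP => //= ->; rewrite iX (negPf iD).
Qed.

(** The products are the probabilities of distinct values of one random subset
    of [D], in which each [i] lies independently with probability [t i]. *)
Lemma trace_weights_le1 t D F :
  (forall i, 0 <= t i <= 1) -> {in F &, injective (fun X => X :&: D)} ->
  \sum_(X in F) \prod_(i in D) (if i \in X then t i else 1 - t i) <= 1.
Proof.
move=> t01 injD.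
(* The law of the random set; subsets not contained in [D] get probability 0. *)
pose w (Y : {set T}) : R :=
  \prod_i (if i \in Y then (if i \in D then t i else 0)
           else (if i \in D then 1 - t i else 1)).
have w_ge0 Y : 0 <= w Y.
  apply: prodr_ge0 => i _; have /andP[? ?] := t01 i.
  by do 2?case: ifP => _ //; rewrite subr_ge0.
have sum_w : \sum_Y w Y = 1.
  rewrite -bigA_distr big1 // => i _.
  by rewrite /=; case: (i \in D); ring.
rewrite (eq_bigr (fun X => w (X :&: D))) => [|X _].
  rewrite -(big_imset w injD) /= -sum_w big_mkcond /=.
  by apply: ler_sum => Y _; case: ifP.
rewrite big_mkcond; apply: eq_bigr => i _; rewrite inE.
by case: (i \in D); case: (i \in X).
Qed.

Lemma union_injective_weights_le1 t D F Y :
  (forall i, 0 <= t i <= 1) ->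
  (forall X X', X \in F -> X' \in F -> X :|: Y = X' :|: Y -> X = X') ->
  \sum_(X in F | X \subset D)
    \prod_(i in D :\: Y) (if i \in X then t i else 1 - t i) <= 1.
Proof.
move=> t01 injY.
rewrite (eq_bigl (mem [set X in F | X \subset D])) => [|X]; last by rewrite /= inE.
apply: trace_weights_le1 => // X X'.
rewrite !inE => /andP[XF /setIidPl XD] /andP[X'F /setIidPl X'D].
rewrite !setIDA XD X'D => eqD; apply: injY => //.
have DU (Z : {set T}) : Z :|: Y = (Z :\: Y) :|: Y.
  by apply/setP=> j; rewrite !inE; case: (j \in Y); rewrite ?orbT ?orbF.
by rewrite DU eqD -DU.
Qed.

End Mass.

(** Each of the two cancellation properties bounds one of the sums of the
    probabilities [u] and [v], and [uvE] factors the product of the weights as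
    [u * v].  Cauchy-Schwarz, with the two families weighted by [alpha] and
    [beta], gives [(x * y) ^ 2 <= x * y] for the two masses [x] and [y]. *)
Lemma weighted_mass_le1 (R : realFieldType) n (s : 'I_n -> R) (D : {set 'I_n})
    (A B : {set {set 'I_n}}) :
  cancellative_pair A B -> (forall i, 0 <= s i <= 1) ->
  mass (fun i => 1 - s i) D D A * mass s D D B <= 1.
Proof.
move=> [cancelA cancelB] s01.
have s0 i : 0 <= s i by case/andP: (s01 i).
have s1 i : 0 <= 1 - s i by rewrite subr_ge0; case/andP: (s01 i).
have s01' i : 0 <= 1 - s i <= 1 by rewrite s1 gerBl s0.
pose alpha (X : {set 'I_n}) : R := \prod_(i in D :\: X) (1 - s i).
pose beta (Y : {set 'I_n}) : R := \prod_(i in D :\: Y) s i.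
pose u (X Y : {set 'I_n}) : R := \prod_(i in D :\: Y) (if i \in X then s i else 1 - s i).
pose v (X Y : {set 'I_n}) : R :=
  \prod_(i in D :\: X) (if i \in Y then 1 - s i else 1 - (1 - s i)).
have alpha0 X : 0 <= alpha X by apply: prodr_ge0.
have beta0 Y : 0 <= beta Y by apply: prodr_ge0.
have u0 X Y : 0 <= u X Y by apply: prodr_ge0 => i _; case: ifP.
have v0 X Y : 0 <= v X Y by apply: prodr_ge0 => i _; case: ifP; rewrite ?subKr.
have uvE X Y : u X Y * v X Y = alpha X * beta Y.
  rewrite /u /v /alpha /beta.
  rewrite !(big_mkcond (fun i => i \in D :\: _)) -!big_split.
  apply: eq_bigr => i _; rewrite !inE /=.
  by case: (i \in X); case: (i \in Y); case: (i \in D) => /=;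
     rewrite ?subKr ?mulr1 ?mul1r // mulrC.
set x := mass _ D D A; set y := mass _ D D B.
have xy0 : 0 <= x * y by rewrite mulr_ge0 ?mass_ge0.
suff: (x * y) ^+ 2 <= x * y by nra.
pose P (p : {set 'I_n} * {set 'I_n}) :=
  [&& p.1 \in A, p.1 \subset D, p.2 \in B & p.2 \subset D].
have pairE (h : {set 'I_n} -> {set 'I_n} -> R) :
    \sum_(X in A | X \subset D) \sum_(Y in B | Y \subset D) h X Y =
    \sum_(p | P p) h p.1 p.2.
  by rewrite pair_big /=; apply: eq_bigl => p; rewrite /P !andbA.
have -> : x * y = \sum_(p | P p) alpha p.1 * beta p.2.
  by rewrite -(pairE (fun X Y => alpha X * beta Y)) -big_distrlr.
apply: le_trans (sum_geometric_mean_sqr_le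
  (p := fun p => alpha p.1 * v p.1 p.2) (q := fun p => beta p.2 * u p.1 p.2)
  _ _ _) _.
- by move=> p _; rewrite mulr_ge0.
- by move=> p _; rewrite mulr_ge0.
- by move=> p _; rewrite mulrACA [v _ _ * _]mulrC uvE expr2.
rewrite -(pairE (fun X Y => alpha X * beta Y)) -big_distrlr /=.
rewrite -(pairE (fun X Y => alpha X * v X Y)) -(pairE (fun X Y => beta Y * u X Y)).
rewrite [X in _ * X <= _]exchange_big /=.
apply: ler_pM.
- by do 2![apply: sumr_ge0 => ? _]; rewrite mulr_ge0.
- by do 2![apply: sumr_ge0 => ? _]; rewrite mulr_ge0.
- apply: ler_sum => X /andP[XA _]; rewrite -big_distrr /= ler_piMr //.
  apply: union_injective_weights_le1 => // Y Y' YB Y'B.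
  by rewrite ![_ :|: X]setUC; apply: cancelB.
- apply: ler_sum => Y /andP[YB _]; rewrite -big_distrr /= ler_piMr //.
  by apply: union_injective_weights_le1 => // X X' XA X'A; apply: cancelA.
Qed.

(** Quantifying over all [D] and all weights is what lets the induction step
    hand the choice of the new weight to [branching_bound]. *)
Lemma partially_weighted_mass_le (R : realFieldType) n (s : 'I_n -> R)
    (D E : {set 'I_n}) (A B : {set {set 'I_n}}) :
  cancellative_pair A B -> (forall i, 0 <= s i <= 1) -> D \subset E ->
  mass (fun i => 1 - s i) D E A * mass s D E B <= (9%:R / 4%:R) ^+ #|E :\: D|.
Proof.
move=> AB; move def_k: #|E :\: D| => k.
elim: k s D E def_k => [|k IHk] s D E def_k s01 sDE.
  have -> : E = D.
    apply/eqP; rewrite eqEsubset sDE andbT -setD_eq0 -cards_eq0.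
    by rewrite def_k.
  exact: weighted_mass_le1.
have s0 i : 0 <= s i by case/andP: (s01 i).
have s1 i : 0 <= 1 - s i by rewrite subr_ge0; case/andP: (s01 i).
have [i iED] : exists i, i \in E :\: D by apply/card_gt0P; rewrite def_k.
have /setDP[iE iD] := iED.
have {def_k} def_k : #|(E :\: D) :\ i| = k.
  by move: def_k; rewrite (cardsD1 i) iED => -[].
rewrite (mass_split _ D E A i) (mass_split _ D E B i) exprS.
apply: branching_bound; rewrite ?mass_ge0 //.
  apply: IHk => //; last by rewrite subsetD1 sDE.
  by rewrite setDDl setUC -setDDl.
move=> r r01; pose s' j := if j == i then r else s j.
have s'i : s' i = r by rewrite /s' eqxx.
have s'D : {in D, s' =1 s}.
  by move=> j jD; rewrite /s'; case: eqP jD => // ->; rewrite (negPf iD).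
rewrite -s'i -(mass_weight E B iD s'D).
rewrite -(mass_weight (t' := fun j => 1 - s' j) E A iD); last first.
  by move=> j /s'D ->.
apply: IHk => [|j|]; last by rewrite subUset sub1set iE.
  by rewrite setUC -setDDl.
by rewrite /s'; case: eqP.
Qed.

Theorem theorem1p1 (n : nat) (n_gt0 : (0 < n)%N) (A B : {set {set 'I_n}}) :
  cancellative_pair A B ->
  #|A|%:R * #|B|%:R <= (9%:R / 4%:R) ^+ n :> rat.
Proof.
move=> AB.
have cardE t (F : {set {set 'I_n}}) : mass t set0 setT F = #|F|%:R :> rat.
  rewrite /mass -sumr_const; apply: eq_big => [X|X _].
    by rewrite subsetT andbT.
  by rewrite set0D big_set0.
have s01 (i : 'I_n) : 0 <= (0 : rat) <= 1 by [].
have := partially_weighted_mass_le AB s01 (sub0set setT).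
by rewrite !cardE setD0 cardsT card_ord.
Qed.
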